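(* Let $w\in S_m$ and $n\ge1$. Then the tropical semiring complexity of $\mathrm{Trop}(F_w(x_1,\dots,x_n))$ is at most $O(n^2\cdot\beta_{\max}(w)_1)$; that is, there is an absolute constant $C$ (independent of $m,n,w$) such that this complexity is at most $C\,n^2\,\beta_{\max}(w)_1$, where $\beta_{\max}(w)_1$ is the first part of the partition $\beta_{\max}(w)$.
   Context: Stanley symmetric function: for $w\in S_m$, $$F_w=\sum_{\mathbf{a}\in\mathrm{Red}(w)}\ \sum_{\mathbf{b}\in C(\mathbf{a})}x_{\mathbf{b}}.$$ Here $\mathrm{Red}(w)$ is the set of reduced words of $w$: sequences $\mathbf{a}=(a_1,\dots,a_\ell)$ with $s_{a_1}s_{a_2}\cdots s_{a_\ell}=w$, where $s_i=(i\ \,i+1)$ and $\ell=\ell(w)$ is the number of inversions of $w$; products are compositions of functions (so right multiplication by $s_i$ swaps the entries in positions $i,i+1$ of the one-line notation). A sequence of positive integers $\mathbf{b}=(b_1,\dots,b_\ell)$ belongs to $C(\mathbf{a})$ if $1\le b_1\le b_2\le\cdots\le b_\ell$ and $a_i<a_{i+1}$ implies $b_i<b_{i+1}$. Finally $x_{\mathbf{b}}=x_{b_1}x_{b_2}\cdots x_{b_\ell}$. $F_w(x_1,\dots,x_n)$ is the polynomial obtained by setting $x_i=0$ for all $i>n$. The Rothe diagram of $w\in S_m$ is $D(w)=\{(i,j):1\le i,j\le m,\ j<w(i),\ i<w^{-1}(j)\}$ (matrix coordinates: $i$ is the row, $j$ the column). Let $q_j$ be the number of boxes of $D(w)$ in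 column $j$, $1\le j\le m$. Then $\beta_{\max}(w)$ is the conjugate of the partition obtained by sorting $(q_1,\dots,q_m)$ in decreasing order. The tropical semiring has operations $a\oplus b=\max(a,b)$ and $a\odot b=a+b$. The tropicalization (with respect to the trivial valuation) of $f=\sum c_{i_1,\dots,i_n}x_1^{i_1}\cdots x_n^{i_n}\in\mathbb{C}[x_1,\dots,x_n]$ is the tropical polynomial $$\mathrm{Trop}(f)=\max\{i_1x_1+\cdots+i_nx_n : c_{i_1,\dots,i_n}\ne 0\}=\bigoplus_{c_{i_1,\dots,i_n}\neq 0}x_1^{\odot i_1}\odot\cdots\odot x_n^{\odot i_n}.$$ By convention the tropicalization of the zero polynomial is the constant $-\infty$ (the empty tropical sum), which is allowed as a constant input below. An arithmetic circuit is a circuit whose inputs are each labelled by a single variable $x_i$ or a fixed constant, in which each gate performs a single $\oplus$ or $\odot$ operation (on two previously computed values or inputs; values may be reused), and which has one output. A circuit $C$ computes a tropical polynomial $\mathrm{res}(C)$ in $x_1,\dots,x_n$. The circuit evaluates a tropical polynomial $g$ if $\mathrm{res}(C)=g$ as tropical polynomials, meaning that the equality can be shown using the semiring axioms together with idempotence $a\oplus a=a$, i.e. $\mathrm{res}(C)$ and $g$ are equal as formal polynomials over the tropical semiring (not merely as functions). The tropical semiring complexity of $g$ is the smallest number of gates in a circuit evaluating $g$. *)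

(* Defs.v *)
From HB Require Import structures.
From mathcomp Require Import all_boot all_order all_fingroup all_algebra.
From mathcomp Require Import reals complex.
From mathcomp Require Import mpoly.

Set Implicit Arguments.
Unset Strict Implicit.
Unset Printing Implicit Defensive.

Import Order.TTheory GRing.Theory Num.Theory.

Local Open Scope ring_scope.

(** Positions, values and letters are numbered from 0: the letter [k] is the
    transposition exchanging the positions [k] and [k.+1] of ['I_m].  Reduced
    words enter [compatible] only through comparisons of their letters, so this
    shift has no effect there. *)

Section Stanley.

Variable m : nat.
Implicit Type w : 'S_m.

Lemma letter_ltn (k : 'I_m.-1) : (k.+1 < m)%N.
Proof. by rewrite -ltn_predRL. Qed.

Definition adjacent_transp (k : 'I_m.-1) : 'S_m :=
  tperm (Ordinal (ltnW (letter_ltn k))) (Ordinal (letter_ltn k)).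

Definition inversions w : {set 'I_m * 'I_m} :=
  [set p : 'I_m * 'I_m | (p.1 < p.2)%N && (w p.2 < w p.1)%N].

Definition perm_length w : nat := #|inversions w|.

(** In MathComp [(s * t) x = t (s x)], so the composition of functions
    s_(a_1) o ... o s_(a_l) is the product of the reversed word. *)
Definition reduced_words w : {set (perm_length w).-tuple 'I_m.-1} :=
  [set a : (perm_length w).-tuple 'I_m.-1 |
    (\prod_(k <- rev a) adjacent_transp k)%g == w].

Definition compatible (l p n : nat)
    (a : l.-tuple 'I_p) (b : l.-tuple 'I_n) : bool :=
  [forall i : 'I_l, forall j : 'I_l, (j == i.+1 :> nat) ==>
     (tnth b i <= tnth b j)%N &&
     ((tnth a i < tnth a j)%N ==> (tnth b i < tnth b j)%N)].

(** F_w(x_1, ..., x_n): the summands x_b that survive x_i = 0 for i > n are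
    those of the sequences b with entries in {1, ..., n}. *)
Definition stanley (K : comNzRingType) (n : nat) w : {mpoly K[n]} :=
  \sum_(a in reduced_words w)
    \sum_(b : (perm_length w).-tuple 'I_n | compatible a b)
      \prod_(i <- b) 'X_i.

Definition rothe_diagram w : {set 'I_m * 'I_m} :=
  [set p : 'I_m * 'I_m | (p.2 < w p.1)%N && (p.1 < (w^-1)%g p.2)%N].

Definition rothe_column w (j : 'I_m) : nat :=
  #|[set i | (i, j) \in rothe_diagram w]|.

(** Meant for weakly decreasing [s], as the number of parts of the conjugate is
    read off the head of [s]. *)
Definition conj_part (s : seq nat) : seq nat :=
  [seq count (fun q => k < q)%N s | k <- iota 0 (head 0%N s)].

Definition beta_max w : seq nat :=
  conj_part (sort geq [seq rothe_column w j | j : 'I_m]).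

End Stanley.

(** [None] stands for -oo. *)

Definition tropical (R : realDomainType) : Type := option R.

Section Tropical.

Variable R : realDomainType.

HB.instance Definition _ := Choice.on (tropical R).

Definition trop_ninfty : tropical R := None.

Definition trop_add (a b : tropical R) : tropical R :=
  match a, b with
  | Some x, Some y => Some (Num.max x y)
  | None, _ => b
  | _, None => a
  end.

Definition trop_mul (a b : tropical R) : tropical R :=
  match a, b with
  | Some x, Some y => Some (x + y)
  | _, _ => None
  end.

Lemma trop_addA : associative trop_add.
Proof. by move=> [x|] [y|] [z|] //=; rewrite maxA. Qed.

Lemma trop_addC : commutative trop_add.
Proof. by move=> [x|] [y|] //=; rewrite maxC. Qed.

Lemma trop_add0 : left_id trop_ninfty trop_add.
Proof. by case. Qed.

Lemma trop_mulA : associative trop_mul.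
Proof. by move=> [x|] [y|] [z|] //=; rewrite addrA. Qed.

Lemma trop_mulC : commutative trop_mul.
Proof. by move=> [x|] [y|] //=; rewrite addrC. Qed.

Lemma trop_mul1 : left_id (Some 0 : tropical R) trop_mul.
Proof. by case=> //= x; rewrite add0r. Qed.

Lemma trop_mulDl : left_distributive trop_mul trop_add.
Proof. by move=> [x|] [y|] [z|] //=; rewrite addr_maxl. Qed.

Lemma trop_mul0 : left_zero trop_ninfty trop_mul.
Proof. by []. Qed.

Lemma trop_1neq0 : (Some 0 : tropical R) != trop_ninfty.
Proof. by []. Qed.

HB.instance Definition _ :=
  GRing.isNmodule.Build (tropical R) trop_addA trop_addC trop_add0.

HB.instance Definition _ :=
  GRing.Nmodule_isComNzSemiRing.Build (tropical R)
    trop_mulA trop_mulC trop_mul1 trop_mulDl trop_mul0 trop_1neq0.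

End Tropical.

(** From here on [0], [1], [+], [*] on [tropical R] are the operations of the
    semiring, namely -oo, the real number 0, max and the addition of reals.

    [mpoly] requires a ring of coefficients, so a polynomial over the tropical
    semiring is given by its coefficient function.  Finiteness of the support is
    not recorded in the type; [tpoly_const] and [tpoly_var] have it, and
    [tpoly_add] and [tpoly_mul] preserve it. *)

Definition tpoly (R : realDomainType) (n : nat) := 'X_{1..n} -> tropical R.

Section TropicalPolynomials.

Variables (R : realDomainType) (n : nat).
Implicit Types p q : tpoly R n.

Definition tpoly_const (c : tropical R) : tpoly R n :=
  fun d => if d == 0%MM then c else 0.

Definition tpoly_var (i : 'I_n) : tpoly R n :=
  fun d => if d == U_(i)%MM then 1 else 0.

Definition tpoly_add p q : tpoly R n := fun d => p d + q d.

Definition tpoly_mul p q : tpoly R n :=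
  fun d => \sum_(k : 'X_{1..n < (mdeg d).+1} | (k <= d)%MM) p k * q (d - k)%MM.

(** Tropicalization with respect to the trivial valuation. *)
Definition Trop (K : nzRingType) (f : {mpoly K[n]}) : tpoly R n :=
  fun d => if f@_d != 0 then 1 else 0.

End TropicalPolynomials.

(** The gates of a circuit are listed in order of evaluation; [Wire k] refers to
    the value of the k-th gate (from 0). *)

Section Circuits.

Variables (R : realDomainType) (n : nat).

Inductive operand :=
  | Var of 'I_n
  | Const of tropical R
  | Wire of nat.

Inductive gate :=
  | AddGate of operand & operand
  | MulGate of operand & operand.

Record circuit := Circuit { gates : seq gate; output : operand }.

Definition operand_ok (k : nat) (x : operand) : bool :=
  if x is Wire j then (j < k)%N else true.

Definition gate_ok (k : nat) (g : gate) : bool :=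
  match g with
  | AddGate x y | MulGate x y => operand_ok k x && operand_ok k y
  end.

Fixpoint gates_ok (k : nat) (gs : seq gate) : bool :=
  if gs is g :: gs' then gate_ok k g && gates_ok k.+1 gs' else true.

Definition well_formed (c : circuit) : bool :=
  gates_ok 0 (gates c) && operand_ok (size (gates c)) (output c).

Definition operand_value (vs : seq (tpoly R n)) (x : operand) : tpoly R n :=
  match x with
  | Var i => tpoly_var R i
  | Const a => tpoly_const a
  | Wire k => nth (tpoly_const 0) vs k
  end.

Definition gate_value (vs : seq (tpoly R n)) (g : gate) : tpoly R n :=
  match g with
  | AddGate x y => tpoly_add (operand_value vs x) (operand_value vs y)
  | MulGate x y => tpoly_mul (operand_value vs x) (operand_value vs y)
  end.

Definition gate_values (gs : seq gate) : seq (tpoly R n) :=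
  foldl (fun vs g => rcons vs (gate_value vs g)) [::] gs.

Definition res (c : circuit) : tpoly R n :=
  operand_value (gate_values (gates c)) (output c).

(** Equality of formal polynomials, coefficient by coefficient, not of the
    functions they induce. *)
Definition evaluates (c : circuit) (g : tpoly R n) : Prop :=
  well_formed c /\ res c =1 g.

Definition tropical_complexity (g : tpoly R n) (s : nat) : Prop :=
  (exists2 c, evaluates c g & size (gates c) = s) /\
  (forall c, evaluates c g -> (s <= size (gates c))%N).

End Circuits.

(* Main.v *)
Require Import Defs.
From mathcomp Require Import all_boot all_order all_fingroup all_algebra.
From mathcomp Require Import reals complex.
From mathcomp Require Import boolp mpoly zify.

(** Column j of the Rothe diagram counts the inversions of w whose smaller value
    is j, that is, how often the value j moves right along a reduced word of w.
    In a block of equal b's the letters of the word decrease, so every value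
    moves right at most once per block.  Hence an exponent d of F_w comes with a
    0-1 matrix whose column sums are the column counts of the Rothe diagram and
    whose row sums are d.  Conversely, such a matrix can be modified, keeping all
    row and column sums, so that its last row is supported on the values with the
    largest column counts (ties broken by leftmost position); these values can be
    moved left by one decreasing block, and one concludes by induction on the
    rows.

    So F_w has the same support as the product of the elementary symmetric
    polynomials e_q over the nonempty columns, q being the number of boxes.  There
    are beta_max(w)_1 such columns, and the recursion
    e_k(x_1..x_i) = x_i e_(k-1)(x_1..x_(i-1)) + e_k(x_1..x_(i-1))
    computes each factor with at most 2 n^2 gates. *)

Set Implicit Arguments.
Unset Strict Implicit.
Unset Printing Implicit Defensive.

Import GRing.Theory Num.Theory.

(** * Column counts of the Rothe diagram under adjacent swaps *)

Section RotheColumns.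

Variable m : nat.
Implicit Types (w : 'S_m) (k : 'I_m.-1) (i j : 'I_m).

Definition lpos k : 'I_m := Ordinal (ltnW (letter_ltn k)).
Definition rpos k : 'I_m := Ordinal (letter_ltn k).

(** A box in row [i] and column [j] is the inversion formed by the positions [i] and
    [(w^-1)%g j]. *)
Lemma sum_rothe_column w : \sum_j rothe_column w j = perm_length w.
Proof.
have -> : perm_length w = \sum_j \sum_i ((i, (w^-1)%g j) \in inversions w).
  rewrite (reindex_inj (@perm_inj _ w)) /= /perm_length -sum1_card.
  rewrite exchange_big /= pair_big /= big_mkcond /=.
  by apply: eq_bigr => -[i j] _ /=; rewrite permK; case: (_ \in _).
apply: eq_bigr => j _; rewrite /rothe_column -sum1_card big_mkcond /=.
by apply: eq_bigr => i _; rewrite !inE /= permKV andbC; case: (_ && _).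
Qed.

Lemma lt_adjacent_transp k i j :
  (adjacent_transp k i < adjacent_transp k j)%N =
  ((i == rpos k) && (j == lpos k) ||
   (i < j)%N && ~~ ((i == lpos k) && (j == rpos k))).
Proof.
rewrite /adjacent_transp -/(lpos k) -/(rpos k) -!val_eqE /=.
by case: tpermP => [->|->|/eqP + /eqP]; case: tpermP => [->|->|/eqP + /eqP];
  rewrite -?val_eqE /=; lia.
Qed.

(** The swap creates one inversion, whose smaller value is [w (lpos k)]; up to relabelling the two
    positions, all other inversions stay the same. *)
Lemma rothe_column_ascent w k j : (w (lpos k) < w (rpos k))%N ->
  rothe_column (adjacent_transp k * w)%g j =
  (rothe_column w j + (j == w (lpos k)))%N.
Proof.
move=> asc; rewrite /rothe_column.
set s := adjacent_transp k.
have sV : (s^-1 = s)%g by rewrite /s /adjacent_transp tpermV.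
have sK i : s (s i) = i by rewrite /s /adjacent_transp tpermK.
rewrite -(card_preimset _ (@perm_inj _ s)).
case: eqVneq => [jE|jNE] /=.
  rewrite addn1 (cardsD1 (rpos k)) addnC -addn1; congr (_ + _)%N; last first.
    rewrite !inE /= invMg permM sV !permM !sK jE asc permK /s.
    by rewrite lt_adjacent_transp !eqxx.
  apply: eq_card => i; rewrite !inE /= invMg permM sV !permM !sK.
  rewrite jE permK lt_adjacent_transp eqxx.
  have ne : lpos k == rpos k = false by rewrite -val_eqE /=; lia.
  rewrite ne !andbF !andbT.
  by case: eqP => [->|_] //=; rewrite ?[(rpos k < lpos k)%N]ltnNge /= ?leqnSn ?andbF.
rewrite addn0; apply: eq_card => i; rewrite !inE /= invMg permM sV !permM !sK.
rewrite lt_adjacent_transp.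
have -> : ((w^-1)%g j == lpos k) = false.
  by apply: contraNF jNE => /eqP <-; rewrite permKV.
rewrite andbF /=; case: (i =P lpos k) => [->|_] /=; last by rewrite andbT.
case: eqP => [jE|_]; last by rewrite andbT.
have -> : j = w (rpos k) by rewrite -jE permKV.
by rewrite ltnNge (ltnW asc).
Qed.

Lemma perm_length_ascent w k : (w (lpos k) < w (rpos k))%N ->
  perm_length (adjacent_transp k * w)%g = (perm_length w).+1.
Proof.
move=> asc; rewrite -!sum_rothe_column.
rewrite (eq_bigr _ (fun j _ => rothe_column_ascent j asc)) big_split /=.
rewrite -[RHS]addn1 [X in _ + X](bigD1 (w (lpos k))) //= eqxx; congr (_ + _).
by rewrite big1 ?addn0 // => j /negPf->.
Qed.

Lemma adjacent_transpK k w : (adjacent_transp k * (adjacent_transp k * w))%g = w.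
Proof. by rewrite mulgA /adjacent_transp tperm2 mul1g. Qed.

Lemma adjacent_transp_rpos k : adjacent_transp k (rpos k) = lpos k.
Proof. exact: tpermR. Qed.

Lemma adjacent_transp_lpos k : adjacent_transp k (lpos k) = rpos k.
Proof. exact: tpermL. Qed.

Lemma perm_ascentVdescent w k :
  (w (lpos k) < w (rpos k))%N \/ (w (rpos k) < w (lpos k))%N.
Proof.
apply/orP; rewrite -neq_ltn; apply/negP => /eqP /val_inj /perm_inj /(congr1 val) /=.
lia.
Qed.

Lemma perm_length_descent w k : (w (rpos k) < w (lpos k))%N ->
  perm_length w = (perm_length (adjacent_transp k * w)%g).+1.
Proof.
move=> desc; rewrite -{1}(adjacent_transpK k w) perm_length_ascent //.
by rewrite !permM adjacent_transp_lpos adjacent_transp_rpos.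
Qed.

Lemma rothe_column_descent w k j : (w (rpos k) < w (lpos k))%N ->
  rothe_column w j =
  (rothe_column (adjacent_transp k * w)%g j + (j == w (rpos k)))%N.
Proof.
move=> desc; rewrite -{1}(adjacent_transpK k w) rothe_column_ascent.
  by rewrite permM adjacent_transp_lpos.
by rewrite !permM adjacent_transp_lpos adjacent_transp_rpos.
Qed.

Lemma rothe_column1 j : rothe_column (1 : 'S_m)%g j = 0%N.
Proof.
apply/eqP; rewrite cards_eq0 -subset0; apply/subsetP => i.
by rewrite !inE /= invg1 !perm1 => /andP[]; lia.
Qed.

Lemma perm_length1 : perm_length (1 : 'S_m)%g = 0%N.
Proof. by rewrite -sum_rothe_column big1 // => j _; rewrite rothe_column1. Qed.

(** Without inversions [w] is increasing, so it sends the sorted list of all positions to a sorted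
    list with the same elements, hence to itself. *)
Lemma perm_length_eq0 w : perm_length w = 0%N -> w = 1%g.
Proof.
move/eqP; rewrite cards_eq0 => /eqP inv0.
have mono : {homo w : i j / (i < j)%N}.
  move=> i j ltij; rewrite ltn_neqAle leqNgt.
  have := in_set0 (i, j); rewrite -inv0 inE /= ltij /= => ->; rewrite andbT.
  by apply/negP => /eqP /val_inj /perm_inj eij; rewrite eij ltnn in ltij.
have lt_tr : transitive (fun i j : 'I_m => i < j)%N by move=> ? ? ?; apply: ltn_trans.
have sorted_enum : sorted (fun i j : 'I_m => i < j)%N (enum 'I_m).
  by have := iota_ltn_sorted 0 m; rewrite -val_enum_ord sorted_map.
have E : map w (enum 'I_m) = enum 'I_m.
  apply: (irr_sorted_eq lt_tr) => //; first by move=> i; exact: ltnn.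
    by rewrite sorted_map; apply: sub_sorted sorted_enum => i j; apply: mono.
  move=> i; rewrite mem_enum; apply/mapP; exists ((w^-1)%g i); rewrite ?permKV //.
  by rewrite mem_enum.
apply/permP => i; rewrite perm1.
by move: E; rewrite -[RHS]map_id => /eq_in_map /(_ i); rewrite mem_enum => /(_ isT).
Qed.

Lemma rothe_column_eq0 w : (forall j, rothe_column w j = 0%N) -> w = 1%g.
Proof.
by move=> q0; apply: perm_length_eq0; rewrite -sum_rothe_column big1.
Qed.

Lemma rothe_column_position w j : (0 < rothe_column w j)%N -> (0 < (w^-1)%g j)%N.
Proof. by case/card_gt0P => i; rewrite !inE /= => /andP[_]; lia. Qed.

(** By contraposition: at an ascent, a position left of [rpos k] with an entry above [w (rpos k)]
    cannot be [lpos k], so it lies left of [lpos k] and is also counted in the column of the smaller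
    value. *)
Lemma descent_rothe_column w k :
  (rothe_column w (w (lpos k)) < rothe_column w (w (rpos k)))%N ->
  (w (rpos k) < w (lpos k))%N.
Proof.
case: (perm_ascentVdescent w k) => // asc.
rewrite ltnNge => /negP[]; apply: subset_leq_card; apply/subsetP => i.
rewrite !inE /= !permK => /andP[lt1 lt2].
have : i != lpos k by apply/eqP => Ei; rewrite Ei in lt1; lia.
rewrite -val_eqE /= => ne; rewrite (ltn_trans asc lt1) /=.
by move: lt2 => /=; lia.
Qed.

End RotheColumns.

(** * Exchanges in 0-1 matrices with fixed row and column sums *)

Section Fillings.

Variables (J I : finType).
Implicit Types (A : J -> {set I}) (S : {set J}).

Lemma exists_top_set (f : J -> nat) (d : nat) : d <= #|J| ->
  exists2 S : {set J}, #|S| = d &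
    forall x y, x \notin S -> y \in S -> f x <= f y.
Proof.
elim: d => [|d IHd] ltd; first by exists set0 => [|x y _]; rewrite ?cards0 ?inE.
have [S cardS topS] := IHd (ltnW ltd).
have /card_gt0P[z0 z0S] : 0 < #|~: S| by rewrite cardsCs setCK cardS subn_gt0.
rewrite inE in z0S; case: (@arg_maxnP _ z0 (fun z => z \notin S) f z0S) => z zS zmax.
exists (z |: S) => [|x y]; first by rewrite cardsU1 zS cardS.
rewrite !inE negb_or => /andP[xz xS] /orP[/eqP->|yS].
  exact: zmax.
exact: topS.
Qed.

(** [A] encodes a 0-1 matrix by its columns: [A j] is the set of rows holding a 1 in column [j]. *)
Definition filling_row A (i : I) : {set J} := [set j | i \in A j].

(* The columns x and y are repaired by exchanging the rows b and i in them. *)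
Lemma exchange_column A b x y : b \in A y -> b \notin A x -> #|A y| <= #|A x| ->
  exists A', [/\ forall j, #|A' j| = #|A j|,
    forall i, #|filling_row A' i| = #|filling_row A i| &
    filling_row A' b = x |: filling_row A b :\ y].
Proof.
move=> by_ bx leyx.
have neq_xy : x != y by apply: contraNneq bx => ->.
(* [A x] is at least as large as [A y] and misses [b], so it cannot be contained in [A y]. *)
have /subsetPn[i ix iy] : ~~ (A x \subset A y).
  apply/negP => sub; have /eqP E : A x == A y by rewrite eqEcard sub.
  by rewrite E by_ in bx.
have neq_ib : i != b by apply: contraNneq bx => <-.
pose t := tperm i b.
pose A' j := if (j == x) || (j == y) then t @^-1: A j else A j.
have A'E j i' : (i' \in A' j) =
    ((if (j == x) || (j == y) then t i' else i') \in A j).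
  by rewrite /A'; case: ifP => _; rewrite ?inE.
exists A'; split.
- by move=> j; rewrite /A'; case: ifP => _ //; rewrite card_preimset //; apply: perm_inj.
- move=> i'.
  have rowE A1 : #|filling_row A1 i'| = (i' \in A1 x) + (i' \in A1 y) +
      \sum_(j | (j != x) && (j != y)) (i' \in A1 j).
    rewrite -sum1_card big_mkcond (bigD1 x) //= (bigD1 y) 1?eq_sym //= addnA.
    by rewrite !inE; congr (_ + _ + _); last apply: eq_bigr => j _;
      rewrite ?inE; case: (_ \in _).
  rewrite !rowE !A'E !eqxx orbT /=; congr (_ + _).
    rewrite /t; case: tpermP => [->|->|/eqP/negPf nei /eqP/negPf neb] //.
    + by rewrite (negPf bx) by_ ix (negPf iy).
    + by rewrite (negPf bx) by_ ix (negPf iy).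
  by apply: eq_bigr => j /andP[/negPf jx /negPf jy]; rewrite A'E jx jy.
- apply/setP => j; rewrite !inE A'E /t.
  case: (eqVneq j x) => [->|_] /=; first by rewrite tpermR ix.
  by case: (eqVneq j y) => [->|_] //=; rewrite tpermR (negPf iy).
Qed.

(** Induction on the number of elements of [S] missing from row [b]: each exchange brings one of
    them in and throws an element outside [S] out. Column sums are kept, so the hypothesis on [S]
    persists. *)
Lemma exchange_row A b S : #|S| = #|filling_row A b| ->
  (forall x y, x \in S -> y \notin S -> #|A y| <= #|A x|) ->
  exists A', [/\ forall j, #|A' j| = #|A j|,
    forall i, #|filling_row A' i| = #|filling_row A i| & filling_row A' b = S].
Proof.
move En : #|S :\: filling_row A b| => n; elim: n A En => [|n IHn] A En cardS topS.
  exists A; split=> //; apply/esym/eqP; rewrite eqEcard cardS leqnn andbT.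
  by rewrite -setD_eq0 -cards_eq0 En.
have /card_gt0P[x] : 0 < #|S :\: filling_row A b| by rewrite En.
rewrite 2!inE => /andP[bx xS].
have /subsetPn[y] : ~~ (filling_row A b \subset S).
  apply/negP => sub; have /eqP ES : filling_row A b == S by rewrite eqEcard sub cardS leqnn.
  by rewrite -ES inE (negPf bx) in xS.
rewrite inE => by_ yS.
have [A1 [col1 row1 row1b]] := exchange_column by_ bx (topS _ _ xS yS).
case: (IHn A1) => [|||A' [col' row' row'b]].
- have -> : S :\: filling_row A1 b = (S :\: filling_row A b) :\ x.
    apply/setP => j; rewrite row1b !inE negb_or negb_and negbK.
    by case: (eqVneq j y) => [->|_]; rewrite ?(negPf yS) ?andbF ?andbT //= andbA.
  by apply/eqP; rewrite -eqSS -En [X in _ == X](cardsD1 x) !inE bx xS.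
- by rewrite row1 cardS.
- by move=> x' y' x'S y'S; rewrite !col1 topS.
exists A'; split=> //.
- by move=> j; rewrite col' col1.
- by move=> i; rewrite row' row1.
Qed.

End Fillings.

(** * Compatible pairs of words and 0-1 matrices *)

Section Biwords.

Variables m n : nat.
Implicit Types (w : 'S_m) (k : 'I_m.-1) (a : seq 'I_m.-1) (b : 'I_n).
Implicit Types (z : seq ('I_m.-1 * 'I_n)) (S : {set 'I_m}).

(** The product is reversed as in [reduced_words], so a new last letter multiplies on the left and
    swaps two adjacent positions. *)
Definition word_perm a : 'S_m := (\prod_(k <- rev a) adjacent_transp k)%g.

Lemma word_perm_rcons a k :
  word_perm (rcons a k) = (adjacent_transp k * word_perm a)%g.
Proof. by rewrite /word_perm rev_rcons big_cons. Qed.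

Lemma word_perm_cat a1 a2 :
  word_perm (a1 ++ a2) = (word_perm a2 * word_perm a1)%g.
Proof. by rewrite /word_perm rev_cat big_cat. Qed.

Lemma word_perm_nil : word_perm [::] = 1%g.
Proof. by rewrite /word_perm big_nil. Qed.

Lemma perm_length_word a : perm_length (word_perm a) <= size a.
Proof.
elim/last_ind: a => [|a k IHa]; first by rewrite word_perm_nil perm_length1.
rewrite word_perm_rcons size_rcons.
case: (perm_ascentVdescent (word_perm a) k) => [/perm_length_ascent-> //|].
by move/perm_length_descent => E; rewrite E in IHa; lia.
Qed.

Definition biword_le (p q : 'I_m.-1 * 'I_n) : bool :=
  (p.2 <= q.2) && ((p.1 < q.1) ==> (p.2 < q.2)).

Lemma inv_adjacent_transp w k j :
  ((adjacent_transp k * w)^-1)%g j = adjacent_transp k ((w^-1)%g j).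
Proof. by rewrite invMg permM /adjacent_transp tpermV. Qed.

(* In a block of equal second entries the letters decrease, so a value that has
   moved to the right of the last letter stays there: it is the smaller value of
   a swap at most once per block. *)
Lemma biword_filling z : pairwise biword_le z ->
  let w := word_perm (unzip1 z) in
  perm_length w = size z ->
  exists A : 'I_m -> {set 'I_n},
    [/\ forall j, #|A j| = rothe_column w j,
        forall i, #|filling_row A i| = count_mem i (unzip2 z) &
        forall z' k b, z = rcons z' (k, b) ->
          w (rpos k) < w (lpos k) /\
          forall j i, i \in A j -> i <= b /\ (i = b -> k < (w^-1)%g j)].
Proof.
elim/last_ind: z => [|z [k b] IHz] /=.
  rewrite word_perm_nil => _ _; exists (fun=> set0); split.
  - by move=> j; rewrite rothe_column1 cards0.
  - by move=> i; apply/eqP; rewrite cards_eq0; apply/eqP/setP => j; rewrite !inE.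
  - by case.
rewrite pairwise_rcons => /andP[/allP le_z /IHz{}IHz].
rewrite /unzip1 /unzip2 !map_rcons -/(unzip1 z) -/(unzip2 z) /= word_perm_rcons size_rcons.
set w := word_perm (unzip1 z) => len.
have le_len := perm_length_word (unzip1 z).
rewrite size_map -/w in le_len.
have asc : w (lpos k) < w (rpos k).
  by case: (perm_ascentVdescent w k) => // /perm_length_descent; lia.
have [|A [colA rowA lastA]] := IHz; first by move: (perm_length_ascent asc); rewrite -/w; lia.
pose j0 := w (lpos k).
(* If [i = b], the last letter [k'] of [z] belongs to the block of [b], so [k <= k']. Equality is
   impossible, as [k] is an ascent of [w] and [k'] a descent. Hence the value [j], placed right of
   [k'], also lies right of [rpos k]. *)
have lastz j i : i \in A j ->
    i <= b /\ (i = b -> (k < (w^-1)%g j) && ((w^-1)%g j != rpos k)).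
  case/lastP: z le_z lastA @w asc colA {len le_len IHz rowA} @j0 =>
      [|z [k' b']] le_z lastA w asc colA j0 ij.
    have := colA j; rewrite /w word_perm_nil rothe_column1 => /eqP.
    by rewrite cards_eq0 => /eqP A0; rewrite A0 inE in ij.
  have [desc] := lastA z k' b' erefl.
  move=> /(_ _ _ ij)[le_ib lt_pos].
  have := le_z (k', b'); rewrite mem_rcons inE eqxx => /(_ isT).
  rewrite /biword_le /= => /andP[le_bb /implyP lt_bb]; split; first by lia.
  move=> Eib; have Eb : b = b' by apply: val_inj; rewrite Eib in le_ib; rewrite /=; lia.
  have {}lt_pos := lt_pos (etrans Eib Eb).
  have ne_k : k != k' :> nat.
    by apply/eqP => /val_inj Ek; move: asc desc; rewrite Ek /w; lia.
  have le_k : k <= k' by rewrite leqNgt; apply/negP => /lt_bb; rewrite Eb ltnn.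
  have lt_kk : k < k' by rewrite ltn_neqAle ne_k.
  rewrite -val_eqE /= (ltn_trans lt_kk lt_pos) /= neq_ltn.
  by rewrite (leq_ltn_trans _ lt_pos) // orbT.
have b_j0 : b \notin A j0.
  by apply/negP => /lastz[_ /(_ erefl)]; rewrite /j0 permK ltnn.
(* The new letter moves the value [j0] right during the block of [b]. *)
exists (fun j => if j == j0 then b |: A j else A j); split.
- move=> j; rewrite rothe_column_ascent // -/j0 -colA.
  by case: eqP => [->|_]; rewrite ?addn0 // cardsU1 b_j0 addnC.
- move=> i; rewrite -cats1 count_cat /= addn0 -rowA.
  case: eqVneq => [<-|neq_ib] /=.
    have -> : filling_row (fun j => if j == j0 then b |: A j else A j) b =
              j0 |: filling_row A b.
      by apply/setP => j; rewrite !inE; case: eqP => // _; rewrite !inE eqxx.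
    by rewrite cardsU1 inE b_j0 addnC.
  rewrite addn0; apply: eq_card => j; rewrite !inE.
  by case: eqP => // _; rewrite !inE eq_sym (negPf neq_ib).
- move=> z' k' b' /rcons_inj[_ <- <-]; split.
    by rewrite !permM adjacent_transp_lpos adjacent_transp_rpos.
  move=> j i; rewrite inv_adjacent_transp; case: eqP => [->|_].
    rewrite !inE => /orP[/eqP->|/lastz[leib ltib]].
      by split=> // _; rewrite /j0 permK adjacent_transp_lpos /=.
    by split=> // /ltib; rewrite /j0 permK ltnn.
  move=> /lastz[leib ltib]; split=> // /ltib.
  rewrite /adjacent_transp -/(lpos k) -/(rpos k) => /andP[].
  by case: tpermP => // ->; rewrite ?eqxx //= ltnn.
Qed.

(* The swaps at the successive positions of the values in S, from left to right,
   each bring the entry preceding S next to the following value of S. *)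
Lemma split_block (e : nat) w S :
  (forall y, y \in S -> e < (w^-1)%g y) ->
  (forall x y, x \notin S -> y \in S -> e <= (w^-1)%g x -> (w^-1)%g x < (w^-1)%g y ->
     rothe_column w x < rothe_column w y) ->
  exists w' c, [/\ w = (word_perm c * w')%g, size c = #|S|,
    pairwise (fun k k' => k' <= k) c, all (fun k : 'I_m.-1 => e <= k) c &
    forall j, rothe_column w j = rothe_column w' j + (j \in S)].
Proof.
move Ed : #|S| => d; elim: d e w S Ed => [|d IHd] e w S Ed posS topS.
  exists w, [::]; split=> //; first by rewrite word_perm_nil mul1g.
  by move=> j; rewrite (cards0_eq Ed) inE addn0.
have /card_gt0P[y' y'S] : 0 < #|S| by rewrite Ed.
case: (@arg_minnP _ y' (fun y => y \in S) (fun y => (w^-1)%g y) y'S) => y yS ymin {y' y'S}.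
have lt_ey := posS _ yS.
have ltk : ((w^-1)%g y).-1 < m.-1 by have := ltn_ord ((w^-1)%g y); lia.
pose k := Ordinal ltk.
have rposE : rpos k = (w^-1)%g y by apply: val_inj => /=; lia.
have lposE : (lpos k).+1 = (w^-1)%g y :> nat by rewrite /=; lia.
have yE : y = w (rpos k) by rewrite rposE permKV.
(* As [y] is the leftmost value of [S], the entry just before it is outside [S] and has a strictly
   smaller column count. *)
have desc : w (rpos k) < w (lpos k).
  apply: descent_rothe_column; rewrite -yE; apply: topS; rewrite ?permK //; try lia.
  by apply/negP => /ymin; rewrite permK; lia.
have := rothe_column_descent _ desc; set w1 := (_ * w)%g => col1.
have pos1 x : (w1^-1)%g x = adjacent_transp k ((w^-1)%g x) by rewrite inv_adjacent_transp.
have pos1S x : x \in S -> x != y -> (w1^-1)%g x = (w^-1)%g x.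
  move=> xS ne_xy; rewrite pos1 /adjacent_transp -/(lpos k) -/(rpos k).
  have le_yx := ymin _ xS.
  apply: tpermD; apply/eqP => E; first by rewrite -E in le_yx; lia.
  by case/eqP: ne_xy; rewrite yE E permKV.
(* The bound becomes the old position of [y]. Thus [y], now one place further left, escapes the
   hypothesis on values outside the set, and all remaining letters exceed [k]. *)
case: (IHd ((w^-1)%g y) w1 (S :\ y)) => [|x|x z|w' [c [w1E sz dec ge col]]].
- by move: Ed; rewrite (cardsD1 y S) yS => -[].
- rewrite !inE => /andP[ne_xy xS]; rewrite pos1S // ltn_neqAle ymin // andbT.
  by rewrite eq_sym; apply: contra ne_xy => /eqP/val_inj/perm_inj->.
- rewrite !inE negb_and negbK => /orP[/eqP->|xS] /andP[ne_zy zS].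
    by rewrite pos1 -rposE adjacent_transp_rpos /=; lia.
  have ne_xy : x != y by apply: contraNneq xS => ->.
  rewrite (pos1S z) // => le_yx lt_xz.
  have := topS x z xS zS.
  rewrite !col1 -yE (negPf ne_xy) (negPf ne_zy) !addn0; apply.
    move: le_yx; rewrite pos1 /adjacent_transp -/(lpos k) -/(rpos k).
    by case: tpermP => [->|->|] /=; lia.
  move: lt_xz le_yx; rewrite pos1 /adjacent_transp -/(lpos k) -/(rpos k).
  by case: tpermP => [->|->|] /=; lia.
exists w', (rcons c k); split.
- by rewrite word_perm_rcons -mulgA -w1E /w1 adjacent_transpK.
- by rewrite size_rcons sz.
- rewrite pairwise_rcons dec andbT; apply/allP => k' /(allP ge) /=; lia.
- rewrite all_rcons; apply/andP; split; first by rewrite /=; lia.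
  by apply/allP => k' /(allP ge) /=; lia.
- move=> j; rewrite col1 col -yE !inE.
  by case: (eqVneq j y) => [->|_]; rewrite ?yS ?addn0 //= addn0.
Qed.

(** Induction on a strict bound [r] of the rows in use. Once the last row is exchanged into a top
    set [S], it yields the final decreasing block, labelled [b]; the other rows form a filling for
    the remaining permutation [w']. *)
Lemma filling_biword w (A : 'I_m -> {set 'I_n}) :
  (forall j, #|A j| = rothe_column w j) ->
  exists z, [/\ pairwise biword_le z, word_perm (unzip1 z) = w,
    size z = perm_length w &
    forall i, count_mem i (unzip2 z) = #|filling_row A i|].
Proof.
suff gen r : r <= n -> forall w (A : 'I_m -> {set 'I_n}),
    (forall j, #|A j| = rothe_column w j) -> (forall j i, i \in A j -> i < r) ->
    exists z, [/\ pairwise biword_le z, word_perm (unzip1 z) = w,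
      size z = perm_length w &
      forall i, count_mem i (unzip2 z) = #|filling_row A i|].
  by move=> colA; apply: (gen n) colA _ => // j i _; apply: ltn_ord.
elim: r {w A} => [|r IHr] ltrn w A colA boundA.
  have A0 j : A j = set0.
    by apply/setP => i; rewrite inE; apply/negP => /boundA.
  exists [::]; split=> //=.
  - by rewrite word_perm_nil [RHS]rothe_column_eq0 // => j; rewrite -colA A0 cards0.
  - by rewrite -sum_rothe_column big1 // => j _; rewrite -colA A0 cards0.
  - move=> i; apply/esym/eqP; rewrite cards_eq0; apply/eqP/setP => j.
    by rewrite !inE A0 inE.
pose b := Ordinal ltrn.
(* Orders the values by column count, ties broken by leftmost position. *)
pose key j := rothe_column w j * m + (m - (w^-1)%g j).
have [|S cardS topS] := @exists_top_set _ key #|filling_row A b|; first exact: max_card.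
(* The second summand of [key] lies between 1 and [m], so column counts are compared first. *)
have key_le x y : key x <= key y -> rothe_column w x <= rothe_column w y.
  rewrite /key; have := ltn_ord ((w^-1)%g x); have := ltn_ord ((w^-1)%g y).
  by move=> ? ? ?; rewrite -ltnS -(@ltn_pmul2r m); lia.
have [|x y xS yS|A1 [col1 row1 row1b]] := @exchange_row _ _ A b S; first exact: cardS.
  by rewrite !colA; apply: key_le; apply: topS.
have S_gt0 y : y \in S -> 0 < rothe_column w y.
  by rewrite -row1b inE => ?; rewrite -colA -col1; apply/card_gt0P; exists b.
have [y yS||w' [c [wE sz dec _ colw]]] := @split_block 0 w S.
- exact: rothe_column_position (S_gt0 _ yS).
(* A value to the left wins every tie, so if it is outside [S] its column count is strictly
   smaller. *)
- move=> x y xS yS _ lt_xy; have := topS x y xS yS; rewrite /key.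
  have := ltn_ord ((w^-1)%g x); have := ltn_ord ((w^-1)%g y).
  by move=> ? ? ?; rewrite -(@ltn_pmul2r m); lia.
(* Row sums are preserved, so the exchanges put nothing into a row beyond [b]. *)
have bound1 j i : i \in A1 j -> i <= r.
  move=> ij; have /card_gt0P[j'] : 0 < #|filling_row A i|.
    by rewrite -row1; apply/card_gt0P; exists j; rewrite inE.
  by rewrite inE => /boundA.
case: (IHr (ltnW ltrn) w' (fun j => A1 j :\ b)).
- move=> j; apply/eqP; rewrite -(eqn_add2r (j \in S)) -colw -colA -col1.
  by rewrite (cardsD1 b (A1 j)) -row1b inE addnC.
- move=> j i; rewrite !inE => /andP[ne_ib /bound1]; rewrite leq_eqVlt.
  by rewrite -(inj_eq val_inj) /= in ne_ib; rewrite (negPf ne_ib).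
move=> z' [sorted' word' size' count'].
have z'b p : p \in z' -> p.2 < r.
  move=> pz; have /card_gt0P[j] : 0 < #|filling_row (fun j => A1 j :\ b) p.2|.
    by rewrite -count' -has_count has_pred1 map_f.
  rewrite !inE -(inj_eq val_inj) /= => /andP[ne /bound1].
  by rewrite leq_eqVlt (negPf ne).
(* All indices in [z'] are smaller than [b], so the block may follow whatever its letters are. *)
exists (z' ++ [seq (k, b) | k <- c]); split.
- rewrite pairwise_cat sorted' /=; apply/andP; split.
    apply/allrelP => p q /z'b ltp /mapP[k _ ->]; rewrite /biword_le /= ltp implybT andbT.
    exact: ltnW.
  rewrite pairwise_map; apply: sub_pairwise dec => k k' lek.
  by rewrite /biword_le /= leqnn ltnNge lek.
- rewrite /unzip1 map_cat -/(unzip1 z') -map_comp word_perm_cat word' wE.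
  by rewrite map_id.
- rewrite size_cat size_map size' sz -!sum_rothe_column.
  rewrite (eq_bigr _ (fun j _ => colw j)) big_split /=; congr (_ + _).
  by rewrite -sum1_card big_mkcond /=; apply: eq_bigr => j _; case: (_ \in _).
- move=> i; rewrite /unzip2 map_cat -map_comp count_cat count' -row1.
  rewrite count_map; case: (eqVneq i b) => [->|ne_ib].
    rewrite (eq_count (a2 := predT)) ?count_predT ?sz; last by move=> k /=; rewrite eqxx.
    rewrite row1b -[RHS]add0n; congr (_ + _); apply/eqP; rewrite cards_eq0.
    by apply/eqP/setP => j; rewrite !inE eqxx.
  rewrite (eq_count (a2 := pred0)) ?count_pred0 ?addn0.
    by apply: eq_card => j; rewrite !inE ne_ib.
  by move=> k /=; rewrite eq_sym (negPf ne_ib).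
Qed.

End Biwords.

(** * The support of the Stanley polynomial *)

Section StanleySupport.

Variables m n : nat.
Implicit Types (w : 'S_m) (d : 'X_{1..n}).

(** If the outer letters increase, so does one of the two steps, and that step is strict in the
    indices. This extends the condition from neighbours to all pairs. *)
Lemma biword_le_trans : transitive (@biword_le m n).
Proof.
move=> [a2 b2] [a1 b1] [a3 b3]; rewrite /biword_le /=.
move=> /andP[le12 /implyP lt12] /andP[le23 /implyP lt23]; rewrite (leq_trans le12) //=.
apply/implyP => lt13; case: (ltnP a1 a2) => [/lt12|le21]; first by lia.
by have := lt23 (leq_ltn_trans le21 lt13); lia.
Qed.

Lemma compatible_pairwise l (a : l.-tuple 'I_m.-1) (b : l.-tuple 'I_n) :
  compatible a b = pairwise (@biword_le m n) (zip a b).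
Proof.
rewrite -(sorted_pairwise biword_le_trans).
case: l a b => [|l] a b.
  by rewrite tuple0 [b]tuple0; apply/forallP => -[].
have size_ab : size (zip a b) = l.+1 by rewrite size_zip !size_tuple minnn.
have nthE (i : 'I_l.+1) :
    nth (tnth a ord0, tnth b ord0) (zip a b) i = (tnth a i, tnth b i).
  by rewrite nth_zip ?size_tuple // -!tnth_nth.
apply/forallP/(sortedP (tnth a ord0, tnth b ord0)) => [cab i|sab i].
  rewrite size_ab => lti; have lti' := ltnW lti.
  have := forallP (cab (Ordinal lti')) (Ordinal lti); rewrite eqxx /=.
  by have := nthE (Ordinal lti'); have := nthE (Ordinal lti) => /= -> ->.
apply/forallP => j; apply/implyP => /eqP Ej.
have := sab i; rewrite size_ab -Ej ltn_ord => /(_ isT).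
by rewrite !nthE.
Qed.

Lemma prod_mpolyX (K : comNzRingType) (s : seq 'I_n) :
  (\prod_(i <- s) 'X_i)%R = ('X_[[multinom count_mem i s | i < n]] : {mpoly K[n]})%R.
Proof.
elim: s => [|j s IHs].
  by rewrite big_nil -mpolyX0; congr mpolyX; apply/mnmP => i; rewrite mnmE mnm0E.
rewrite big_cons IHs -mpolyXD; congr mpolyX.
by apply/mnmP => i; rewrite mnmDE !mnmE.
Qed.

Lemma mcoeff_stanley (K : comNzRingType) w d :
  ((stanley K n w)@_d)%R =
  (\sum_(a in reduced_words w) \sum_(b : (perm_length w).-tuple 'I_n | compatible a b)
    ([multinom count_mem i b | i < n] == d))%N%:R%R :> K.
Proof.
rewrite /stanley raddf_sum natr_sum; apply: eq_bigr => a _.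
rewrite raddf_sum natr_sum; apply: eq_bigr => b _.
by rewrite prod_mpolyX /= mcoeffX.
Qed.

(** A coefficient counts compatible pairs, so over a [numDomainType] nothing cancels: it is nonzero
    exactly when a pair exists, and pairs and fillings produce each other. *)
Lemma stanley_supportP (K : numDomainType) w d :
  reflect (exists A : 'I_m -> {set 'I_n},
      (forall j, #|A j| = rothe_column w j) /\
      (forall i, d i = #|filling_row A i|))
    ((stanley K n w)@_d != 0)%R.
Proof.
rewrite mcoeff_stanley pnatr_eq0 sum_nat_eq0.
apply: (iffP idP) => [|[A [colA rowA]]].
  rewrite negb_forall => /existsP[a]; rewrite negb_imply => /andP[red_a].
  rewrite sum_nat_eq0 negb_forall => /existsP[b]; rewrite negb_imply => /andP[cab].
  rewrite eqb0 negbK => /eqP <-.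
  rewrite compatible_pairwise in cab.
  rewrite inE in red_a; move/eqP: red_a => red_a.
  have E1 : unzip1 (zip a b) = a by rewrite unzip1_zip // !size_tuple.
  have E2 : unzip2 (zip a b) = b by rewrite unzip2_zip // !size_tuple.
  have := biword_filling cab; rewrite E1 E2 /= [word_perm a]red_a.
  rewrite size_zip !size_tuple minnn => /(_ erefl)[A [colA rowA _]].
  by exists A; split=> // i; rewrite mnmE rowA.
have [z [zle zw zlen zcount]] := filling_biword colA.
have size1 : size (unzip1 z) == perm_length w by rewrite size_map zlen.
have size2 : size (unzip2 z) == perm_length w by rewrite size_map zlen.
apply/negP => /forallP/(_ (Tuple size1))/implyP; rewrite inE => /(_ _)/eqP.
move=> /(_ (introT eqP zw))/eqP.
rewrite sum_nat_eq0 => /forallP/(_ (Tuple size2))/implyP.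
rewrite compatible_pairwise /= zip_unzip => /(_ zle); rewrite eqb0 => /eqP[].
by apply/mnmP => i; rewrite mnmE rowA zcount.
Qed.

End StanleySupport.

(** * Tropical polynomials given by their supports *)

Section SupportPolynomials.

Variables (R : realDomainType) (n : nat).
Implicit Types (P Q : pred 'X_{1..n}) (d : 'X_{1..n}) (p q : tpoly R n).

(** The coefficients are the real number 0 on [P] and -oo elsewhere. By idempotence this form is
    stable under both operations, so it suffices to compute with supports. *)
Definition supp_tpoly P : tpoly R n := fun d => if P d then 1%R else 0%R.

Definition supp_mul P Q : pred 'X_{1..n} := fun d =>
  [exists k : 'X_{1..n < (mdeg d).+1}, (k <= d)%MM && (P k && Q (d - k)%MM)].

Lemma supp_mulP P Q d :
  reflect (exists k1 k2, [/\ d = (k1 + k2)%MM, P k1 & Q k2]) (supp_mul P Q d).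
Proof.
apply: (iffP existsP) => [[k /and3P[le_kd Pk Qk]]|[k1 [k2 [-> P1 Q2]]]].
  by exists k, (d - k)%MM; split=> //; rewrite addmC submK.
have lt : mdeg k1 < (mdeg (k1 + k2)%MM).+1 by rewrite mdegD ltnS leq_addr.
by exists (BMultinom lt) => /=; rewrite P1 lem_addr //= addmC addmK.
Qed.

Lemma trop_1D1 : (1 + 1 = 1 :> tropical R)%R.
Proof. by congr Some; rewrite Order.POrderTheory.maxxx. Qed.

Lemma trop_sum_bool (T : finType) (B C : pred T) :
  (\sum_(k | B k) (if C k then 1 else 0) : tropical R)%R =
  (if [exists k, B k && C k] then 1 else 0)%R.
Proof.
case: existsP => [[k /andP[Bk Ck]]|none]; last first.
  rewrite big1 // => k Bk; case: ifP => // Ck.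
  by case: none; exists k; rewrite Bk.
rewrite (bigD1 k) //= Ck.
apply: (big_ind (fun x => (1 + x = 1 :> tropical R)%R)) => [|x y Ex Ey|j _].
- exact: GRing.addr0.
- by rewrite GRing.addrA Ex Ey.
- by case: ifP => _; rewrite ?trop_1D1 ?GRing.addr0.
Qed.

Lemma tpoly_add_supp p q P Q : p =1 supp_tpoly P -> q =1 supp_tpoly Q ->
  tpoly_add p q =1 supp_tpoly (predU P Q).
Proof.
move=> pE qE d; rewrite /tpoly_add pE qE /supp_tpoly /=.
by case: (P d); case: (Q d); rewrite ?trop_1D1 ?GRing.addr0 ?GRing.add0r.
Qed.

Lemma tpoly_mul_supp p q P Q : p =1 supp_tpoly P -> q =1 supp_tpoly Q ->
  tpoly_mul p q =1 supp_tpoly (supp_mul P Q).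
Proof.
move=> pE qE d; rewrite /tpoly_mul /supp_tpoly /supp_mul -trop_sum_bool.
apply: eq_bigr => k _; rewrite pE qE /supp_tpoly.
by case: (P _); case: (Q _); rewrite ?GRing.mulr1 ?GRing.mulr0 ?GRing.mul0r.
Qed.

Lemma eq_supp_tpoly P Q : P =1 Q -> supp_tpoly P =1 supp_tpoly Q.
Proof. by move=> PQ d; rewrite /supp_tpoly PQ. Qed.

Lemma const0_supp : (tpoly_const 0%R : tpoly R n) =1 supp_tpoly pred0.
Proof. by move=> d; rewrite /tpoly_const if_same. Qed.

(* Exponents of the monomials of e_k in the first i variables. *)
Definition esym_supp (i k : nat) : pred 'X_{1..n} := fun d =>
  [forall j, d j <= (j < i)] && (mdeg d == k).

Lemma esym_supp0r i : esym_supp i 0 =1 pred1 0%MM.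
Proof.
move=> d; rewrite /esym_supp mdeg_eq0 /=; case: eqP => [->|]; rewrite ?andbF //.
by rewrite andbT; apply/forallP => j; rewrite mnm0E.
Qed.

Lemma esym_supp0l k : esym_supp 0 k.+1 =1 pred0.
Proof.
move=> d; apply/negP => /andP[/forallP d0]; rewrite mdegE big1 // => j _.
by apply/eqP; have := d0 j; rewrite ltn0 leqn0.
Qed.

Lemma esym_supp_big k : n < k -> esym_supp n k =1 pred0.
Proof.
move=> ltnk d; apply/negP => /andP[/forallP d1 /eqP dk].
suff : mdeg d <= n by lia.
rewrite mdegE -[X in _ <= X]card_ord -sum1_card; apply: leq_sum => j _.
by have := d1 j; rewrite ltn_ord.
Qed.

(** The exponent of variable [i] is 0 or 1; these cases give the second and the first term. *)
Lemma esym_suppS (i : 'I_n) k : esym_supp i.+1 k.+1 =1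
  predU (supp_mul (pred1 U_(i)%MM) (esym_supp i k)) (esym_supp i k.+1).
Proof.
move=> d; apply/idP/orP => [/andP[/forallP d1 /eqP dk]|].
  case: (posnP (d i)) => [di0|di_gt0]; [right|left].
    apply/andP; split; last by rewrite dk.
    apply/forallP => j; case: (eqVneq j i) => [->|]; first by rewrite di0.
    by rewrite -val_eqE /= => ne; have := d1 j; rewrite (ltnS j) (leq_eqVlt j) (negPf ne).
  have le_id : (U_(i) <= d)%MM.
    by apply/mnm_lepP => j; rewrite mnm1E; case: eqP => // <-.
  apply/supp_mulP; exists U_(i)%MM, (d - U_(i))%MM; split.
  - by rewrite addmC submK.
  - exact: eqxx.
  apply/andP; split.
    apply/forallP => j; rewrite mnmBE mnm1E; have := d1 j.
    case: (eqVneq i j) => [<-|]; first by rewrite ltnSn ltnn leqn0 subn_eq0.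
    by rewrite -val_eqE /= eq_sym subn0 => ne; rewrite (ltnS j) (leq_eqVlt j) (negPf ne).
  have := congr1 (@mdeg n) (submK le_id); rewrite mdegD mdeg1 dk addn1 => -[->].
  exact: eqxx.
case=> [/supp_mulP[k1 [k2 [-> /eqP-> /andP[/forallP d1 /eqP dk]]]]|].
  apply/andP; split; last by rewrite mdegD mdeg1 dk.
  apply/forallP => j; rewrite mnmDE mnm1E; have := d1 j.
  case: (eqVneq i j) => [<-|_]; first by rewrite ltnSn ltnn leqn0 => /eqP->.
  by rewrite add0n (ltnS j) => /leq_trans; apply; case: (ltnP j i) => // /ltnW->.
move=> /andP[/forallP d1 dk]; apply/andP; split=> //; apply/forallP => j.
by apply: leq_trans (d1 j) _; rewrite (ltnS j); case: (ltnP j i) => // /ltnW->.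
Qed.

Fixpoint prod_esym_supp (qs : seq nat) : pred 'X_{1..n} :=
  if qs is q :: qs' then supp_mul (esym_supp n q) (prod_esym_supp qs')
  else pred1 0%MM.

Lemma prod_esym_supp0 qs : prod_esym_supp (0 :: qs) =1 prod_esym_supp qs.
Proof.
move=> d; apply/supp_mulP/idP => [[k1 [k2 [->]]]|dP].
  by rewrite esym_supp0r => /eqP->; rewrite add0m.
by exists 0%MM, d; rewrite add0m esym_supp0r /=.
Qed.

Lemma esym_supp_set (B : {set 'I_n}) :
  esym_supp n #|B| [multinom (i \in B : nat) | i < n].
Proof.
apply/andP; split; first by apply/forallP => i; rewrite mnmE ltn_ord leq_b1.
apply/eqP; rewrite mdegE -sum1_card [RHS]big_mkcond /=.
by apply: eq_bigr => i _; rewrite mnmE; case: (_ \in _).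
Qed.

Lemma esym_suppP k d :
  reflect (exists2 B : {set 'I_n}, #|B| = k & d = [multinom (i \in B : nat) | i < n])
    (esym_supp n k d).
Proof.
apply: (iffP idP) => [/andP[/forallP d1 /eqP dk]|[B <- ->]]; last exact: esym_supp_set.
have dE : d = [multinom (i \in [set i | d i != 0] : nat) | i < n].
  by apply/mnmP => i; rewrite mnmE inE; have := d1 i; rewrite ltn_ord; case: (d i) => [|[]].
exists [set i | d i != 0] => //; rewrite -dk {2}dE.
by have /andP[_ /eqP] := esym_supp_set [set i | d i != 0].
Qed.

(** Each factor contributes a squarefree monomial, that is, a set of [q j] variables. As [s] has no
    repetition, these choices assemble into one function of [j]. *)
Lemma prod_esym_suppP (J : eqType) (s : seq J) (q : J -> nat) d : uniq s ->
  reflect (exists A : J -> {set 'I_n},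
      {in s, forall j, #|A j| = q j} /\
      (forall i, d i = count (fun j => i \in A j) s))
    (prod_esym_supp [seq q j | j <- s] d).
Proof.
elim: s d => [|j s IHs] d /=.
  move=> _; apply: (iffP eqP) => [->|[A [_ d0]]].
    by exists (fun=> set0); split=> // i; rewrite mnm0E.
  by apply/mnmP => i; rewrite d0 mnm0E.
case/andP=> js /IHs{}IHs; apply: (iffP (supp_mulP _ _ _)).
  move=> [k1 [k2 [-> /esym_suppP[B cardB ->] /IHs[A [colA rowA]]]]].
  exists (fun j' => if j' == j then B else A j'); split.
    move=> j'; rewrite inE; case: eqP => [->|_] //= ; exact: colA.
  move=> i; rewrite mnmDE mnmE rowA eqxx; congr (_ + _).
  by apply: eq_in_count => j' sj'; case: eqP js => // <-; rewrite sj'.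
move=> [A [colA rowA]].
exists [multinom (i \in A j : nat) | i < n],
  [multinom count (fun j' => i \in A j') s | i < n]; split.
- by apply/mnmP => i; rewrite mnmDE !mnmE rowA.
- by apply/esym_suppP; exists (A j); rewrite // colA ?mem_head.
- apply/IHs; exists A; split=> [j' sj'|i]; last by rewrite mnmE.
  by rewrite colA // inE sj' orbT.
Qed.

End SupportPolynomials.

(** * Circuits for products of elementary symmetric polynomials *)

Section Circuits.

Variables (R : realDomainType) (n : nat).
Implicit Types (P Q : pred 'X_{1..n}) (gs h : seq (gate R n)).
Implicit Types (g : gate R n) (x y : operand R n).

Lemma gate_values_rcons gs g :
  gate_values (rcons gs g) = rcons (gate_values gs) (gate_value (gate_values gs) g).
Proof. by rewrite /gate_values foldl_rcons. Qed.

Lemma size_gate_values gs : size (gate_values gs) = size gs.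
Proof.
elim/last_ind: gs => [//|gs g IHgs].
by rewrite gate_values_rcons !size_rcons IHgs.
Qed.

Lemma gate_values_cat gs h : exists vs, gate_values (gs ++ h) = gate_values gs ++ vs.
Proof.
elim/last_ind: h => [|h g [vs IHh]]; first by exists [::]; rewrite !cats0.
by rewrite -rcons_cat gate_values_rcons IHh rcons_cat; eexists.
Qed.

Lemma gates_ok_rcons k gs g :
  gates_ok k (rcons gs g) = gates_ok k gs && gate_ok (k + size gs) g.
Proof.
elim: gs k => [|g' gs IHgs] k /=; first by rewrite addn0 andbT.
by rewrite IHgs addSnnS andbA.
Qed.

(** Requiring [operand_ok] keeps a wire among the existing gates, so its value survives when gates
    are appended. *)
Definition available gs P x : Prop :=
  operand_ok (size gs) x /\ operand_value (gate_values gs) x =1 supp_tpoly R P.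

Lemma available_cat gs h P x : available gs P x -> available (gs ++ h) P x.
Proof.
case=> okx valx; split.
  by case: x okx {valx} => //= k ltk; rewrite size_cat ltn_addr.
have [vs ->] := gate_values_cat gs h.
move=> d; rewrite -valx; case: x okx {valx} => //= k ltk.
by rewrite nth_cat size_gate_values ltk.
Qed.

Lemma eq_available gs P Q x : P =1 Q -> available gs P x -> available gs Q x.
Proof. by move=> PQ [okx valx]; split=> // d; rewrite valx; apply: eq_supp_tpoly. Qed.

Lemma available0 gs : available gs pred0 (Const n (0%R : tropical R)).
Proof. by split=> //; apply: const0_supp. Qed.

Lemma available1 gs : available gs (pred1 0%MM) (Const n (1%R : tropical R)).
Proof. by []. Qed.

Lemma available_var gs i : available gs (pred1 U_(i)%MM) (Var R i).
Proof. by []. Qed.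

Definition extends (N : nat) gs gs' : Prop :=
  exists h, [/\ gs' = gs ++ h, size h <= N & gates_ok 0 gs'].

Lemma extends_refl N gs : gates_ok 0 gs -> extends N gs gs.
Proof. by exists [::]; rewrite cats0. Qed.

Lemma extends_ok N gs gs' : extends N gs gs' -> gates_ok 0 gs'.
Proof. by case=> h []. Qed.

Lemma extends_trans N1 N2 gs1 gs2 gs3 :
  extends N1 gs1 gs2 -> extends N2 gs2 gs3 -> extends (N1 + N2) gs1 gs3.
Proof.
move=> [h1 [-> sz1 _]] [h2 [-> sz2 ok]]; exists (h1 ++ h2).
by rewrite catA size_cat leq_add.
Qed.

Lemma extends_leq N1 N2 gs gs' : N1 <= N2 -> extends N1 gs gs' -> extends N2 gs gs'.
Proof. by move=> le12 [h [-> sz ok]]; exists h; rewrite (leq_trans sz). Qed.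

Lemma extends_available N gs gs' P x :
  extends N gs gs' -> available gs P x -> available gs' P x.
Proof. by case=> h [-> _ _]; apply: available_cat. Qed.

Lemma available_add gs P Q x y : gates_ok 0 gs ->
  available gs P x -> available gs Q y ->
  exists gs' z, extends 1 gs gs' /\ available gs' (predU P Q) z.
Proof.
move=> ok [okx valx] [oky valy].
exists (rcons gs (AddGate x y)), (Wire R n (size gs)); split.
  exists [:: AddGate x y]; split=> //; first by rewrite cats1.
  by rewrite gates_ok_rcons ok /= okx.
split; first by rewrite size_rcons /=.
move=> d; rewrite gate_values_rcons /= nth_rcons size_gate_values ltnn eqxx /=.
exact: tpoly_add_supp.
Qed.

Lemma available_mul gs P Q x y : gates_ok 0 gs ->
  available gs P x -> available gs Q y ->
  exists gs' z, extends 1 gs gs' /\ available gs' (supp_mul P Q) z.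
Proof.
move=> ok [okx valx] [oky valy].
exists (rcons gs (MulGate x y)), (Wire R n (size gs)); split.
  exists [:: MulGate x y]; split=> //; first by rewrite cats1.
  by rewrite gates_ok_rcons ok /= okx.
split; first by rewrite size_rcons /=.
move=> d; rewrite gate_values_rcons /= nth_rcons size_gate_values ltnn eqxx /=.
exact: tpoly_mul_supp.
Qed.

(** Each degree from 1 to [q] costs one multiplication and one addition; degree 0 is a constant. *)
Lemma available_esym_row (i : 'I_n) q gs f : gates_ok 0 gs ->
  (forall k, k <= q -> available gs (esym_supp i k) (f k)) ->
  exists gs' f', extends (2 * q) gs gs' /\
    forall k, k <= q -> available gs' (esym_supp i.+1 k) (f' k).
Proof.
move=> ok avf; suff gen r : r <= q -> exists gs' f', extends (2 * r) gs gs' /\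
    forall k, k <= r -> available gs' (esym_supp i.+1 k) (f' k) by exact: gen.
elim: r => [_|r IHr ltrq].
  exists gs, (fun=> Const n (1%R : tropical R)); split; first exact: extends_refl.
  move=> k; rewrite leqn0 => /eqP->; apply: eq_available (available1 _) => d.
  by rewrite esym_supp0r.
have [gs1 [f1 [ext1 av1]]] := IHr (ltnW ltrq).
have avr := extends_available ext1 (avf _ (ltnW ltrq)).
have [gs2 [x2 [ext2 av2]]] :=
  available_mul (extends_ok ext1) (available_var gs1 i) avr.
have avr1 := extends_available ext2 (extends_available ext1 (avf _ ltrq)).
have [gs3 [x3 [ext3 av3]]] := available_add (extends_ok ext2) av2 avr1.
exists gs3, (fun k => if k == r.+1 then x3 else f1 k); split.
  apply: extends_leq (extends_trans ext1 (extends_trans ext2 ext3)); lia.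
move=> k; case: eqP => [-> _|ne lek].
  by apply: eq_available av3 => d; rewrite esym_suppS.
apply: extends_available ext3 (extends_available ext2 (av1 _ _)); lia.
Qed.

Lemma available_esym q gs : gates_ok 0 gs ->
  exists gs' x, extends (2 * n ^ 2) gs gs' /\ available gs' (esym_supp n q) x.
Proof.
move=> ok; case: (leqP q n) => [leqn|ltnq]; last first.
  (* With more factors than variables the polynomial is zero, and the constant -oo costs no gate. *)
  exists gs, (Const n (0%R : tropical R)); split; first exact: extends_refl.
  by apply: eq_available (available0 _) => d; rewrite esym_supp_big.
suff gen i : i <= n -> exists gs' f, extends (i * (2 * q)) gs gs' /\
    forall k, k <= q -> available gs' (esym_supp i k) (f k).
  have [gs' [f [ext avf]]] := gen n (leqnn n).
  exists gs', (f q); split; last exact: avf.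
  by apply: extends_leq ext; nia.
elim: i => [_|i IHi lti].
  (* In no variables, e_0 is the tropical [1] and every other e_k is -oo. *)
  exists gs, (fun k => Const n (if k is 0 then 1 else 0 : tropical R)%R).
  split=> [|[|k] _]; first exact: extends_refl.
    by apply: eq_available (available1 _) => d; rewrite esym_supp0r.
  by apply: eq_available (available0 _) => d; rewrite esym_supp0l.
have [gs1 [f1 [ext1 av1]]] := IHi (ltnW lti).
have [gs2 [f2 [ext2 av2]]] := @available_esym_row (Ordinal lti) q _ _ (extends_ok ext1) av1.
exists gs2, f2; split=> //.
by apply: extends_leq (extends_trans ext1 ext2); lia.
Qed.

Lemma available_prod_esym qs gs : 0 < n -> gates_ok 0 gs ->
  exists gs' x, extends (3 * n ^ 2 * count (fun q => 0 < q) qs) gs gs' /\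
    available gs' (prod_esym_supp qs) x.
Proof.
move=> n_gt0; elim: qs gs => [|q qs IHqs] gs ok.
  exists gs, (Const n (1%R : tropical R)); split; [exact: extends_refl|exact: available1].
have [gs1 [x1 [ext1 av1]]] := IHqs gs ok.
(* An empty column gives the factor e_0, which costs no gate. *)
case: (posnP q) => [->|q_gt0].
  by exists gs1, x1; split=> //; apply: eq_available av1 => d; rewrite prod_esym_supp0.
have [gs2 [x2 [ext2 av2]]] := available_esym q (extends_ok ext1).
have [gs3 [x3 [ext3 av3]]] :=
  available_mul (extends_ok ext2) av2 (extends_available ext2 av1).
exists gs3, x3; split=> //.
apply: extends_leq (extends_trans ext1 (extends_trans ext2 ext3)).
(* The factor takes at most [2 * n ^ 2] gates and the product one more; [0 < n] bounds this by
   [3 * n ^ 2]. *)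
by rewrite /= q_gt0; nia.
Qed.

End Circuits.

(** * The number of nonempty columns and the complexity bound *)

Lemma count_rothe_column m (w : 'S_m) :
  count (fun q => 0 < q) [seq rothe_column w j | j <- enum 'I_m] <= nth 0 (beta_max w) 0.
Proof.
rewrite /beta_max /conj_part; set s := sort _ _.
have -> : count (fun q => 0 < q) [seq rothe_column w j | j <- enum 'I_m] =
          count (fun q => 0 < q) s by rewrite count_sort.
case: (posnP (count (fun q => 0 < q) s)) => [-> //|].
rewrite -has_count => /hasP[q qs q_gt0].
(* A positive head gives the conjugate a part of index 0, which counts the positive entries. *)
suff head_gt0 : 0 < head 0 s by rewrite (nth_map 0) ?size_iota // nth_iota.
have : sorted geq s by apply: sort_sorted => x y; exact: leq_total.
case: s qs => // q0 s; rewrite inE /= => /orP[/eqP<- //|qs].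
rewrite path_sortedE; last by move=> x y z /= xy yz; apply: leq_trans yz xy.
by case/andP=> /allP/(_ _ qs) /= le _; apply: leq_trans le.
Qed.

(** Both supports consist of the row sums of 0-1 matrices whose column sums are the column counts of
    the diagram. *)
Lemma Trop_stanley (R : realDomainType) (K : numDomainType) (m n : nat) (w : 'S_m) :
  Trop R (stanley K n w) =1
  supp_tpoly R (prod_esym_supp [seq rothe_column w j | j <- enum 'I_m]).
Proof.
have rowE (A : 'I_m -> {set 'I_n}) i :
    #|filling_row A i| = count (fun j => i \in A j) (enum 'I_m).
  by rewrite cardsE cardE enumT /enum_mem size_filter.
move=> d; rewrite /Trop /supp_tpoly.
have := prod_esym_suppP (rothe_column w) d (enum_uniq 'I_m).
case: stanley_supportP => [[A [colA rowA]]|no]; case=> //.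
  by case; exists A; split=> // i; rewrite rowA rowE.
case=> A [colA rowA]; case: no; exists A; split=> [j|i].
  by rewrite colA ?mem_enum.
by rewrite rowA rowE.
Qed.

(** One evaluating circuit makes the set of sizes nonempty; classical logic turns membership into a
    boolean so that a minimum can be taken. *)
Lemma tropical_complexity_le (R : realDomainType) (n : nat) (f : tpoly R n) c :
  evaluates c f -> exists2 s, tropical_complexity f s & s <= size (gates c).
Proof.
move=> cf; pose P s := `[< exists2 c, evaluates c f & size (gates c) = s >].
have exP : exists s, P s by exists (size (gates c)); apply/asboolP; exists c.
case: (ex_minnP exP) => s /asboolP Ps mins; exists s; last first.
  by apply: mins; apply/asboolP; exists c.
by split=> // c' c'f; apply: mins; apply/asboolP; exists c'.
Qed.

Theorem theorem3p2 :
  exists C : nat,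
    forall (R : realType) (m n : nat) (w : 'S_m), (1 <= n)%N ->
      exists2 s : nat,
        tropical_complexity (Trop R (stanley (complex R) n w)) s &
        (s <= C * n ^ 2 * nth 0 (beta_max w) 0)%N.
Proof.
exists 3 => R m n w n_gt0.
have [gs [x [[h [gsE size_h ok]] [okx valx]]]] :=
  @available_prod_esym R n [seq rothe_column w j | j <- enum 'I_m] [::] n_gt0 isT.
have [|s comp le_s] :=
    @tropical_complexity_le R n (Trop R (stanley (complex R) n w)) (Circuit gs x).
  by split; [rewrite /well_formed /= ok | move=> d; rewrite Trop_stanley -valx].
exists s => //; apply: leq_trans le_s _; rewrite gsE /=; apply: leq_trans size_h _.
by rewrite leq_mul2l count_rothe_column orbT.
Qed.
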